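(* Let $(\Omega,\leftarrow,\rightarrow,\triangleleft,\triangleright)$ be a finite nonempty nondegenerate extended diassociative semigroup (EDS) such that $\alpha\leftarrow\beta=\alpha$ and $\alpha\rightarrow\beta=\beta$ for all $\alpha,\beta\in\Omega$. Then there exist a group $(H,\star)$, a nonempty set $K$ and a map $\theta:K\to H$ such that $\Omega$ is isomorphic to $\mathbf{EDS}^*(H,\star,K,\theta)$.
   Context: Extended diassociative semigroups. A diassociative semigroup is a set $\Omega$ with maps $\leftarrow,\rightarrow:\Omega\times\Omega\to\Omega$ such that for all $\alpha,\beta,\gamma\in\Omega$: $(\alpha\leftarrow\beta)\leftarrow\gamma=\alpha\leftarrow(\beta\leftarrow\gamma)=\alpha\leftarrow(\beta\rightarrow\gamma)$; $(\alpha\rightarrow\beta)\leftarrow\gamma=\alpha\rightarrow(\beta\leftarrow\gamma)$; $(\alpha\rightarrow\beta)\rightarrow\gamma=(\alpha\leftarrow\beta)\rightarrow\gamma=\alpha\rightarrow(\beta\rightarrow\gamma)$. An extended diassociative semigroup (EDS) is $(\Omega,\leftarrow,\rightarrow,\triangleleft,\triangleright)$ such that $(\Omega,\leftarrow,\rightarrow)$ is a diassociative semigroup and for all $\alpha,\beta,\gamma\in\Omega$: $\alpha\triangleright(\beta\leftarrow\gamma)=\alpha\triangleright\beta$; $(\alpha\rightarrow\beta)\triangleleft\gamma=\beta\triangleleft\gamma$; $(\alpha\triangleleft\beta)\leftarrow((\alpha\leftarrow\beta)\triangleleft\gamma)=\alpha\triangleleft(\beta\leftarrow\gamma)$; $(\alpha\triangleleft\beta)\triangleleft((\alpha\leftarrow\beta)\triangleleft\gamma)=\beta\triangleleft\gamma$;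 $(\alpha\triangleleft\beta)\rightarrow((\alpha\leftarrow\beta)\triangleleft\gamma)=\alpha\triangleleft(\beta\rightarrow\gamma)$; $(\alpha\triangleleft\beta)\triangleright((\alpha\leftarrow\beta)\triangleleft\gamma)=\beta\triangleright\gamma$; $(\alpha\triangleright(\beta\rightarrow\gamma))\leftarrow(\beta\triangleright\gamma)=(\alpha\leftarrow\beta)\triangleright\gamma$; $(\alpha\triangleright(\beta\rightarrow\gamma))\triangleleft(\beta\triangleright\gamma)=\alpha\triangleleft\beta$; $(\alpha\triangleright(\beta\rightarrow\gamma))\rightarrow(\beta\triangleright\gamma)=(\alpha\rightarrow\beta)\triangleright\gamma$; $(\alpha\triangleright(\beta\rightarrow\gamma))\triangleright(\beta\triangleright\gamma)=\alpha\triangleright\beta$. It is nondegenerate if the maps $\varphi_\leftarrow:(\alpha,\beta)\mapsto(\alpha\leftarrow\beta,\alpha\triangleleft\beta)$ and $\varphi_\rightarrow:(\alpha,\beta)\mapsto(\alpha\rightarrow\beta,\alpha\triangleright\beta)$ from $\Omega^2$ to $\Omega^2$ are bijective. An isomorphism of EDS is a bijection compatible with the four operations. For a group $(H,\star)$, a nonempty set $K$ and a map $\theta:K\to H$, $\mathbf{EDS}^*(H,\star,K,\theta)$ is the set $H\times K$ with $(\alpha,\alpha')\leftarrow(\beta,\beta')=(\alpha,\alpha')$, $(\alpha,\alpha')\rightarrow(\beta,\beta')=(\beta,\beta')$, $(\alpha,\alpha')\triangleleft(\beta,\beta')=(\alpha^{-1}\star\beta,\beta')$, $(\alpha,\alpha')\triangleright(\beta,\beta')=(\theta(\beta')\star\beta^{-1}\star\alpha,\alpha')$.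 *)

(* Defs.v *)
From HB Require Import structures.
From mathcomp Require Import all_boot fingroup.
Set Implicit Arguments.
Unset Strict Implicit.
Unset Printing Implicit Defensive.
Import GroupScope.

Local Reserved Notation "x ← y" (at level 40, no associativity).
Local Reserved Notation "x → y" (at level 40, no associativity).
Local Reserved Notation "x ◁ y" (at level 40, no associativity).
Local Reserved Notation "x ▷ y" (at level 40, no associativity).

Record diassociative (T : Type) (larr rarr : T -> T -> T) : Prop :=
  Diassociative {
    larrA : forall a b c, larr (larr a b) c = larr a (larr b c);
    larr_rarr : forall a b c, larr a (larr b c) = larr a (rarr b c);
    rarr_larrA : forall a b c, larr (rarr a b) c = rarr a (larr b c);
    rarr_larr : forall a b c, rarr (rarr a b) c = rarr (larr a b) c;
    rarrA : forall a b c, rarr (larr a b) c = rarr a (rarr b c)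
  }.

Record eds (T : Type) : Type := EDS {
  larr : T -> T -> T where "x ← y" := (larr x y);
  rarr : T -> T -> T where "x → y" := (rarr x y);
  ltri : T -> T -> T where "x ◁ y" := (ltri x y);
  rtri : T -> T -> T where "x ▷ y" := (rtri x y);
  eds_diassociative : diassociative larr rarr;
  rtri_larr : forall a b c, a ▷ (b ← c) = a ▷ b;
  ltri_rarr : forall a b c, (a → b) ◁ c = b ◁ c;
  ltri_larrE : forall a b c, (a ◁ b) ← ((a ← b) ◁ c) = a ◁ (b ← c);
  ltri_ltriE : forall a b c, (a ◁ b) ◁ ((a ← b) ◁ c) = b ◁ c;
  ltri_rarrE : forall a b c, (a ◁ b) → ((a ← b) ◁ c) = a ◁ (b → c);
  ltri_rtriE : forall a b c, (a ◁ b) ▷ ((a ← b) ◁ c) = b ▷ c;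
  rtri_larrE : forall a b c, (a ▷ (b → c)) ← (b ▷ c) = (a ← b) ▷ c;
  rtri_ltriE : forall a b c, (a ▷ (b → c)) ◁ (b ▷ c) = a ◁ b;
  rtri_rarrE : forall a b c, (a ▷ (b → c)) → (b ▷ c) = (a → b) ▷ c;
  rtri_rtriE : forall a b c, (a ▷ (b → c)) ▷ (b ▷ c) = a ▷ b
}.

Definition phi_larr (T : Type) (E : eds T) (p : T * T) : T * T :=
  (larr E p.1 p.2, ltri E p.1 p.2).

Definition phi_rarr (T : Type) (E : eds T) (p : T * T) : T * T :=
  (rarr E p.1 p.2, rtri E p.1 p.2).

Definition nondegenerate (T : Type) (E : eds T) : Prop :=
  bijective (phi_larr E) /\ bijective (phi_rarr E).

Definition eds_isomorphic (T U : Type) (E : eds T) (F : eds U) : Prop :=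
  exists f : T -> U,
    [/\ bijective f,
        {morph f : x y / larr E x y >-> larr F x y},
        {morph f : x y / rarr E x y >-> rarr F x y},
        {morph f : x y / ltri E x y >-> ltri F x y} &
        {morph f : x y / rtri E x y >-> rtri F x y}].

Definition star_larr (H : groupType) (K : Type) (x y : H * K) : H * K := x.

Definition star_rarr (H : groupType) (K : Type) (x y : H * K) : H * K := y.

Definition star_ltri (H : groupType) (K : Type) (x y : H * K) : H * K :=
  (x.1^-1 * y.1, y.2).

Definition star_rtri (H : groupType) (K : Type) (theta : K -> H)
    (x y : H * K) : H * K :=
  (theta y.2 * y.1^-1 * x.1, x.2).

Definition eds_star (H : groupType) (K : Type) (theta : K -> H) :
  eds (H * K).
Proof.
refine (@EDS (H * K)%type (@star_larr H K) (@star_rarr H K) (@star_ltri H K)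
  (star_rtri theta) _ _ _ _ _ _ _ _ _ _ _) => //;
  move=> a b c; rewrite /star_larr /star_rarr /star_ltri /star_rtri //=;
  by rewrite !(invgM, invgK, mulgA) ?mulgVK ?mulgK.
Defined.

(* Main.v *)
Require Import Defs.
From HB Require Import structures.
From mathcomp Require Import all_boot fingroup.
From mathcomp Require Import perm.
Set Implicit Arguments.
Unset Strict Implicit.
Unset Printing Implicit Defensive.
Import GroupScope.

(** Write L_a for the map b |-> a ◁ b, a permutation of Omega by nondegeneracy.
    The axiom (a ◁ b) ◁ (a ◁ c) = b ◁ c says L_(a ◁ b) = L_b o L_a^-1, so
    H = {L_a | a in Omega} is a group of permutations, which acts freely on
    Omega.  The orbit of a meets K = {k | L_k = id} exactly in a ◁ a, and
    a |-> (L_a, a ◁ a) is a bijection from Omega to H * K turning ◁ into that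
    of EDS^*.  Finally (a ▷ c) ◁ (b ▷ c) = a ◁ b forces L_(a ▷ c) to be a
    translate of L_a by an element depending only on c, which the invariance
    (c ◁ a) ▷ (c ◁ b) = a ▷ b expresses through theta k = L_(k ▷ k). *)

Section TrivialArrows.

Variables (Omega : finType) (E : eds Omega).
Hypothesis nondegE : nondegenerate E.
Hypothesis larrE : forall a b : Omega, larr E a b = a.
Hypothesis rarrE : forall a b : Omega, rarr E a b = b.

Local Notation "x ◁ y" := (ltri E x y) (at level 40, no associativity).
Local Notation "x ▷ y" := (rtri E x y) (at level 40, no associativity).

Lemma ltri_ltri a b c : (a ◁ b) ◁ (a ◁ c) = b ◁ c.
Proof. by rewrite -(ltri_ltriE E a b c) larrE. Qed.

Lemma ltri_rtri a b c : (a ◁ b) ▷ (a ◁ c) = b ▷ c.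
Proof. by rewrite -(ltri_rtriE E a b c) larrE. Qed.

Lemma rtri_ltri a b c : (a ▷ c) ◁ (b ▷ c) = a ◁ b.
Proof. by rewrite -(rtri_ltriE E a b c) rarrE. Qed.

Lemma ltri_inj a : injective (ltri E a).
Proof.
move=> b c eq_ab_ac; have [/bij_inj phi_inj _] := nondegE.
suff [] : (a, b) = (a, c) by [].
by apply: phi_inj; rewrite /phi_larr /= !larrE eq_ab_ac.
Qed.

Definition ltri_perm a : {perm Omega} := perm (@ltri_inj a).

Lemma ltri_permE a b : ltri_perm a b = a ◁ b.
Proof. exact: permE. Qed.

(* Permutations multiply left to right: the right-hand side is L_b o L_a^-1. *)
Lemma ltri_perm_ltri a b : ltri_perm (a ◁ b) = (ltri_perm a)^-1 * ltri_perm b.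
Proof.
by apply: (mulgI (ltri_perm a)); rewrite mulKVg; apply/permP => c;
   rewrite permM !ltri_permE ltri_ltri.
Qed.

Lemma ltri_perm_diag a : ltri_perm (a ◁ a) = 1.
Proof. by rewrite ltri_perm_ltri mulVg. Qed.

(** Applying [b ◁ _] to both arguments turns the right one into [k = b ◁ b]; [rtri_ltri] then
    compares [(b ◁ a) ▷ k] with [k ▷ k], and [ltri_perm k] is trivial. *)
Lemma ltri_perm_rtri a b :
  ltri_perm (a ▷ b) =
  ltri_perm ((b ◁ b) ▷ (b ◁ b)) * (ltri_perm b)^-1 * ltri_perm a.
Proof.
rewrite -[in LHS](ltri_rtri b) -mulgA -ltri_perm_ltri; set k := b ◁ b.
apply: (mulgI (ltri_perm (k ▷ k))^-1).
by rewrite mulKg -ltri_perm_ltri rtri_ltri ltri_perm_ltri ltri_perm_diag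
           invg1 mul1g.
Qed.

Definition ltri_perms : {set {perm Omega}} := [set ltri_perm a | a : Omega].

Lemma mem_ltri_perms a : ltri_perm a \in ltri_perms.
Proof. exact: imset_f. Qed.

Lemma ltri_perms_group_set (a0 : Omega) : group_set ltri_perms.
Proof.
apply/group_setP; split; first by rewrite -(ltri_perm_diag a0) mem_ltri_perms.
move=> _ _ /imsetP[a _ ->] /imsetP[b _ ->].
(* As [ltri_perm (a ◁ a) = 1], the element [a ◁ (a ◁ a)] realizes [(ltri_perm a)^-1], which the
   outer [◁] inverts back. *)
suff -> : ltri_perm a * ltri_perm b = ltri_perm ((a ◁ (a ◁ a)) ◁ b).
  exact: mem_ltri_perms.
by rewrite !ltri_perm_ltri mulVg mulg1 invgK.
Qed.

Lemma eds_isomorphic_star (a0 : Omega) :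
  exists (H : groupType) (K : Type) (theta : K -> H),
    inhabited K /\ eds_isomorphic E (eds_star theta).
Proof.
pose G := group (ltri_perms_group_set a0).
pose K := {k : Omega | ltri_perm k == 1}.
have diagK a : ltri_perm (a ◁ a) == 1 by rewrite ltri_perm_diag.
pose h a : subg_of G := subg G (ltri_perm a).
pose kappa a : K := exist _ (a ◁ a) (diagK a).
have hE a : sgval (h a) = ltri_perm a by rewrite subgK ?mem_ltri_perms.
exists (subg_of G), K, (fun k : K => h (val k ▷ val k)).
split; first exact: (inhabits (kappa a0)).
exists (fun a => (h a, kappa a)); split=> [| a b | a b | a b | a b] /=.
(* Since [a ◁ a] is the image of [a] under [ltri_perm a], the inverse map sends [(g, k)] to the
   preimage of [k] under [g]. *)
- exists (fun p => ((sgval p.1)^-1 : {perm Omega}) (val p.2)) =>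
    [a | [g [k kP]]] /=.
    by rewrite hE -ltri_permE permK.
  have /eqP k1 := kP; have /imsetP[c _ gc] := subgP g.
  rewrite gc; set a := fun_of_perm _ k.
  (* Triviality of [ltri_perm k] forces [a] and [c] to have the same permutation, which yields both
     coordinates. *)
  have ca : c ◁ a = k by rewrite -ltri_permE permKV.
  have ac : ltri_perm a = ltri_perm c.
    by apply: (mulgI (ltri_perm c)^-1); rewrite -ltri_perm_ltri ca k1 mulVg.
  congr (_, _); first by apply: val_inj; rewrite /= hE ac.
  by apply: val_inj; rewrite /= -ltri_permE ac ltri_permE.
- by rewrite larrE.
- by rewrite rarrE.
- congr (_, _); last by apply: val_inj; rewrite /= ltri_ltri.
  by apply: val_inj; rewrite /= !hE ltri_perm_ltri.
- congr (_, _); last by apply: val_inj; rewrite /= rtri_ltri.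
  by apply: val_inj; rewrite /= !hE ltri_perm_rtri.
Qed.

End TrivialArrows.

Theorem proposition10 (Omega : finType) (E : eds Omega) :
  inhabited Omega ->
  nondegenerate E ->
  (forall a b : Omega, larr E a b = a) ->
  (forall a b : Omega, rarr E a b = b) ->
  exists (H : groupType) (K : Type) (theta : K -> H),
    inhabited K /\ eds_isomorphic E (eds_star theta).
Proof.
by move=> [a0] nondegE larrE rarrE; apply: eds_isomorphic_star a0.
Qed.
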